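(* Let $F$ be a field, $X$ an indeterminate over $F$, $D_n=F[X^{\frac{1}{2^n}},X^{-\frac{1}{2^n}}]$ for each $n\in\mathbb{N}_0$ and $D=\bigcup_{n\in\mathbb{N}_0}D_n$. The following statements are equivalent. (1) $\mathrm{char}(F)\neq 2$. (2) $D$ is an almost Dedekind domain. (3) $D$ is an SP domain. (4) Each nonunit of $D$ that is not a product of finitely many prime elements of $D$ is contained in infinitely many maximal ideals of $D$. (5) $D$ is not of finite character. (6) Each proper principal ideal of $D$ is a finite product of radical principal ideals of $D$.
   Context: $\mathbb{N}_0$ is the set of nonnegative integers. The elements $X^{1/2^n}$ are compatible roots of $X$, i.e. $(X^{1/2^{n+1}})^2=X^{1/2^n}$, so $D_n\subsetneq D_{n+1}$. An almost Dedekind domain is an integral domain $D$ such that $D_M$ is a DVR for every maximal ideal $M$ of $D$. An SP domain is an integral domain in which each proper ideal can be written as a finite product of radical ideals. An integral domain is of finite character if each nonzero nonunit is contained in only finitely many maximal ideals. *)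

(* Defs.v *)
From HB Require Import structures.
From mathcomp Require Import all_boot all_order all_algebra.
From mathcomp Require Import all_classical.

Set Implicit Arguments.
Unset Strict Implicit.
Unset Printing Implicit Defensive.

Import GRing.Theory.
Local Open Scope classical_set_scope.
Local Open Scope ring_scope.

(* Ideals are classical sets: the ideals of ring_quotient (idealr) are
   decidable predicates and always proper. *)
Section Ideals.
Variable R : comNzRingType.
Implicit Types (I J M P : set R) (a b p : R).

Definition is_ideal I :=
  [/\ I 0, forall a b, I a -> I b -> I (a + b)
         & forall r a, I a -> I (r * a)].

Definition is_proper_ideal I := is_ideal I /\ I <> [set: R].

Definition is_prime_ideal P :=
  is_proper_ideal P /\ forall a b, P (a * b) -> P a \/ P b.

Definition is_maximal_ideal M :=
  is_proper_ideal M /\ forall J, is_proper_ideal J -> M `<=` J -> J = M.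

Definition principal a : set R := [set r * a | r in [set: R]].

Definition is_principal_ideal I := exists a, I = principal a.

Definition radical I : set R := [set a | exists n, I (a ^+ n)].

Definition is_radical_ideal I := is_ideal I /\ radical I = I.

Definition ideal_mul I J : set R :=
  [set c | exists2 s : seq (R * R),
     (forall u, u \in s -> I u.1 /\ J u.2) & c = \sum_(u <- s) u.1 * u.2].

(* The empty product is the whole ring. *)
Definition ideal_prod (s : seq (set R)) : set R :=
  \big[ideal_mul/[set: R]]_(J <- s) J.

Definition maximal_ideals_at a : set (set R) :=
  [set M | is_maximal_ideal M /\ M a].

Definition divides a b := exists c, b = c * a.

End Ideals.

Lemma maximal_prime_ideal (R : comNzRingType) (M : set R) :
  is_maximal_ideal M -> is_prime_ideal M.
Proof.
move=> [[[M0 MD MM] Mprop] Mmax]; split=> // a b Mab.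
have [Ma|nMa] := pselect (M a); [by left|right].
pose J : set R := [set c | exists m r, M m /\ c = m + r * a].
have Jid : is_ideal J.
  split.
  - by exists 0, 0; rewrite mul0r addr0.
  - move=> c d [m [r [Mm ->]]] [m' [r' [Mm' ->]]].
    by exists (m + m'), (r + r'); split; [exact: MD|rewrite mulrDl addrACA].
  - move=> t c [m [r [Mm ->]]]; exists (t * m), (t * r).
    by split; [exact: MM|rewrite mulrDr mulrA].
have MJ : M `<=` J by move=> m Mm; exists m, 0; rewrite mul0r addr0.
have [JT|JT] := pselect (J = setT); last first.
  case: nMa; rewrite -(Mmax J)//; exists 0, 1.
  by rewrite mul1r add0r.
have [m [r [Mm e1]]] : J 1 by rewrite JT.
rewrite -[b]mul1r e1 mulrDl; apply: MD; first by rewrite mulrC; exact: MM.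
by rewrite -mulrA; exact: MM.
Qed.

Definition is_subring (K : nzRingType) (S : set K) :=
  subring_closed (fun y => y \in S).

Record subring (K : fieldType) := Subring {
  subring_set :> set K;
  subring_setP : is_subring subring_set }.

Section SubringDomain.
Variables (K : fieldType) (S : subring K).

Definition subring_pred : {pred K} := fun y => y \in (S : set K).

Fact subring_predP : subring_closed subring_pred.
Proof. exact: (subring_setP S). Qed.

HB.instance Definition _ :=
  GRing.isSubringClosed.Build K subring_pred subring_predP.

(* Used both for the domain under study and for its localizations. A unit of
   the subring is an element whose inverse in K stays in the subring. *)
Definition subring_dom := {y : K | subring_pred y}.

HB.instance Definition _ := SubChoice.on subring_dom.
HB.instance Definition _ :=
  [SubChoice_isSubComNzRing of subring_dom by <:].

Definition subring_unit : {pred subring_dom} :=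
  fun a => (val a != 0) && subring_pred (val a)^-1.

Definition subring_inv (a : subring_dom) : subring_dom :=
  if subring_unit a then insubd a (val a)^-1 else a.

Fact subring_mulVr : {in subring_unit, left_inverse 1 subring_inv *%R}.
Proof.
move=> a ua; apply: val_inj; rewrite /subring_inv ifT//.
case/andP: ua => a0 aV; rewrite rmorphM rmorph1/= insubdK//.
exact: mulVf.
Qed.

Fact subring_unitP (a b : subring_dom) : b * a = 1 -> subring_unit a.
Proof.
move=> /(congr1 val); rewrite rmorphM rmorph1/= => ba1.
have a0 : val a != 0.
  by apply: contra_eq_neq ba1 => ->; rewrite mulr0 eq_sym oner_neq0.
rewrite /subring_unit a0/=.
suff -> : (val a)^-1 = val b by exact: valP.
by apply: (mulIf a0); rewrite mulVf// ba1.
Qed.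

Fact subring_inv_out : {in [predC subring_unit], subring_inv =1 id}.
Proof. by move=> a /negPf ua; rewrite /subring_inv ifF. Qed.

HB.instance Definition _ := GRing.ComNzRing_hasMulInverse.Build subring_dom
  subring_mulVr subring_unitP subring_inv_out.

Fact subring_integral : GRing.integral_domain_axiom subring_dom.
Proof.
move=> a b /(congr1 val); rewrite rmorphM/= => /eqP; rewrite mulf_eq0.
by rewrite -!(inj_eq val_inj).
Qed.

HB.instance Definition _ :=
  GRing.ComUnitRing_isIntegral.Build subring_dom subring_integral.

End SubringDomain.

Section Domains.
Variable R : idomainType.
Implicit Types (I J M P : set R) (a b p : R).

Definition is_prime_element p :=
  [/\ p != 0, p \isn't a GRing.unit &
      forall a b, divides p (a * b) -> divides p a \/ divides p b].

Definition prime_product a :=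
  exists2 s : seq R,
    (forall p, p \in s -> is_prime_element p) & a = \prod_(p <- s) p.

(* A discrete valuation ring: a local principal ideal domain, not a field. *)
Definition is_dvr :=
  [/\ forall I, is_ideal I -> is_principal_ideal I,
      exists! M, is_maximal_ideal M &
      exists a, a != 0 /\ a \isn't a GRing.unit].

Definition localization_set P : set {fraction R} :=
  [set y | exists a b, ~ P b /\ y = tofrac a / tofrac b].

Fact localization_subring P : is_prime_ideal P -> is_subring (localization_set P).
Proof.
move=> [[[P0 PD PM] Pprop] Pprime].
have nP1 : ~ P 1.
  move=> P1; apply: Pprop; rewrite -subTset => a _.
  by rewrite -[a]mulr1; exact: PM.
have nP0 b : ~ P b -> tofrac b != 0.
  by move=> nPb; rewrite tofrac_eq0; apply: contra_notN nPb => /eqP ->.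
have nPM b c : ~ P b -> ~ P c -> ~ P (b * c).
  by move=> nPb nPc /Pprime[].
split.
- by apply/mem_set; exists 1, 1; rewrite tofrac1 divr1.
- move=> y z /set_mem[a [b [nPb ->]]] /set_mem[c [d [nPd ->]]].
  apply/mem_set; exists (a * d - c * b), (b * d); split; first exact: nPM.
  by rewrite tofracB !tofracM -mulNr addf_div ?nP0// mulNr.
- move=> y z /set_mem[a [b [nPb ->]]] /set_mem[c [d [nPd ->]]].
  apply/mem_set; exists (a * c), (b * d); split; first exact: nPM.
  by rewrite !tofracM mulf_div.
Qed.

Definition localization P (primeP : is_prime_ideal P) : idomainType :=
  subring_dom (Subring (localization_subring primeP)).

End Domains.

Definition almost_dedekind (R : idomainType) :=
  forall (M : set R) (maxM : is_maximal_ideal M),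
    is_dvr (localization (maximal_prime_ideal maxM)).

Definition sp_domain (R : idomainType) :=
  forall I : set R, is_proper_ideal I ->
    exists2 s : seq (set R),
      (forall J, J \in s -> is_radical_ideal J) & I = ideal_prod s.

Definition finite_character (R : idomainType) :=
  forall a : R, a != 0 -> a \isn't a GRing.unit ->
    finite_set (maximal_ideals_at a).

Section DyadicLaurent.
Variables (F L : fieldType) (iota : {rmorphism F -> L}).

(* F[a, b] *)
Definition adjoin2 (a b : L) : set L :=
  smallest (@is_subring L) (range iota `|` [set a; b]).

(* x n plays the role of X^(1/2^n), inside a field L that contains all these
   roots; X = x 0 is assumed to be transcendental over F where it matters. *)
Variable x : nat -> L.

Definition laurent (n : nat) : set L := adjoin2 (x n) (x n)^-1.

(* The increasing union of the F[X^(1/2^n), X^(-1/2^n)]; it is turned into an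
   integral domain by dyadic_laurent below. *)
Definition laurent_union : set L := \bigcup_n laurent n.

Fact adjoin2_subring a b : is_subring (adjoin2 a b).
Proof.
split.
- by apply/mem_set => S /= [[S1 _ _] _]; exact/set_mem.
- move=> y z /set_mem ys /set_mem zs; apply/mem_set => S /= [Ssub Sgen].
  have [_ SB _] := Ssub.
  by apply/set_mem/SB; apply/mem_set; [exact: ys|exact: zs].
- move=> y z /set_mem ys /set_mem zs; apply/mem_set => S /= [Ssub Sgen].
  have [_ _ SM] := Ssub.
  by apply/set_mem/SM; apply/mem_set; [exact: ys|exact: zs].
Qed.

Hypothesis xS : forall n, x n.+1 ^+ 2 = x n.

Fact laurentS n : laurent n `<=` laurent n.+1.
Proof.
have [_ _ AM] := adjoin2_subring (x n.+1) (x n.+1)^-1.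
have mulA y z : laurent n.+1 y -> laurent n.+1 z -> laurent n.+1 (y * z).
  by move=> ys zs; apply/set_mem/AM; exact/mem_set.
have gen : range iota `|` [set x n.+1; (x n.+1)^-1] `<=` laurent n.+1.
  exact: sub_gen_smallest.
have xn : laurent n.+1 (x n.+1) by apply: gen; right; left.
have xnV : laurent n.+1 (x n.+1)^-1 by apply: gen; right; right.
apply: smallest_sub; first exact: adjoin2_subring.
move=> y [yF|[->|->]]; first by apply: gen; left.
- by rewrite -xS expr2; exact: mulA.
- by rewrite -xS expr2 invfM; exact: mulA.
Qed.

Fact laurent_union_subring : is_subring laurent_union.
Proof.
have mono m n : (m <= n)%N -> laurent m `<=` laurent n.
  move=> /subnK <-; elim: (n - m)%N => [//|k IHk] y /IHk.
  by rewrite addSn; exact: laurentS.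
split.
- apply/mem_set; exists 0%N => //.
  by have [/set_mem] := adjoin2_subring (x 0%N) (x 0%N)^-1.
- move=> y z /set_mem[m _ ym] /set_mem[n _ zn].
  apply/mem_set; exists (maxn m n) => //.
  have [_ AB _] := adjoin2_subring (x (maxn m n)) (x (maxn m n))^-1.
  apply/set_mem/AB; apply/mem_set.
    exact: mono (leq_maxl m n) _ ym.
  exact: mono (leq_maxr m n) _ zn.
- move=> y z /set_mem[m _ ym] /set_mem[n _ zn].
  apply/mem_set; exists (maxn m n) => //.
  have [_ _ AM] := adjoin2_subring (x (maxn m n)) (x (maxn m n))^-1.
  apply/set_mem/AM; apply/mem_set.
    exact: mono (leq_maxl m n) _ ym.
  exact: mono (leq_maxr m n) _ zn.
Qed.

Definition dyadic_laurent : idomainType :=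
  subring_dom (Subring laurent_union_subring).

End DyadicLaurent.

(* Main.v *)
(* Call r radical when r | b^2 implies r | b.  Let R be a Bezout domain in which
   every nonzero a divides a power r^N of a radical r <> 0.  Then gcd(a, r) is
   the radical of a, so peeling off such gcds writes a as a product of radical
   elements; for an ideal I containing a, I = rad(I) (I : rad(I)) and the
   second factor contains an element dividing r^(N-1), so R is an SP domain; a
   radical r in M is a uniformizer at the maximal ideal M; and a radical element
   lying in finitely many maximal ideals is a product of primes, as a radical
   nonprime splits into two coprime nonunits.

   If char F <> 2, D is such a ring: radical elements of D_n stay radical in
   D_(n+1) = D_n + D_n X^(1/2^(n+1)).  Moreover X - 1 is divisible by all the
   pairwise coprime X^(1/2^n) + 1, n > 0, hence D is not of finite character.

   If char F = 2, then y_n = X^(1/2^n) - 1 satisfies y_(n+1)^2 = y_n, which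
   refutes all factorization properties, while a^(2^k) is in D_n for large k
   allows one to bound the maximal ideals containing an element of D_n. *)

Require Import Defs.
From HB Require Import structures.
From mathcomp Require Import all_boot all_order all_algebra.
From mathcomp Require Import all_classical.
From mathcomp Require Import ring.

Set Implicit Arguments.
Unset Strict Implicit.
Unset Printing Implicit Defensive.

Import GRing.Theory.
Local Open Scope classical_set_scope.
Local Open Scope ring_scope.

(** * Ideals *)

Section IdealTheory.
Variable R : comNzRingType.
Implicit Types (I J M : set R) (a b c : R) (s : seq (set R)).

Lemma principal_is_ideal a : is_ideal (principal a).
Proof.
split; first by exists 0; rewrite ?mul0r.
- by move=> _ _ [r _ <-] [t _ <-]; exists (r + t); rewrite ?mulrDl.
- by move=> t _ [r _ <-]; exists (t * r); rewrite ?mulrA.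
Qed.

Lemma principal1 : principal (1 : R) = [set: R].
Proof. by apply/seteqP; split=> // a _; exists a; rewrite ?mulr1. Qed.

Lemma ideal_sum I (T : eqType) (s : seq T) (f : T -> R) :
  is_ideal I -> (forall u, u \in s -> I (f u)) -> I (\sum_(u <- s) f u).
Proof.
move=> [I0 ID _] fI; rewrite big_seq.
by apply: (big_ind I) => // u us; exact: fI.
Qed.

Lemma ideal_setT I : is_ideal I -> I 1 -> I = [set: R].
Proof.
move=> [_ _ IM] I1; apply/seteqP; split=> // a _.
by rewrite -[a]mulr1; exact: IM.
Qed.

Lemma proper_ideal1 I : is_proper_ideal I -> ~ I 1.
Proof. by move=> [Iid IT] I1; exact/IT/ideal_setT. Qed.

Lemma ideal_exp I a n : is_ideal I -> I a -> (0 < n)%N -> I (a ^+ n).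
Proof. by move=> [_ _ IM] Ia; case: n => // n _; rewrite exprSr; exact: IM. Qed.

Lemma radical_is_ideal I : is_ideal I -> is_ideal (radical I).
Proof.
move=> Iid; have [I0 ID IM] := Iid; split; first by exists 1%N.
- move=> a b [m am] [n bn]; exists (m + n)%N; rewrite exprDn.
  apply: ideal_sum => // -[i ilt] _ /=; rewrite -mulr_natl; apply: (IM).
  have [le_in|lt_ni] := leqP i n.
    rewrite (_ : m + n - i = (n - i) + m)%N; last by rewrite addnC addnBAC.
    by rewrite exprD mulrAC; exact: IM.
  by rewrite -(subnK (ltnW lt_ni)) [b ^+ _]exprD mulrA; exact: IM.
- by move=> r a [n an]; exists n; rewrite exprMn; exact: IM.
Qed.

Lemma radical_sub I : I `<=` radical I.
Proof. by move=> a Ia; exists 1%N. Qed.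

Lemma radical_is_radical I : is_ideal I -> is_radical_ideal (radical I).
Proof.
move=> Iid; split; first exact: radical_is_ideal.
apply/seteqP; split; last exact: radical_sub.
by move=> a [n [m]]; rewrite -exprM => ?; exists (n * m)%N.
Qed.

Lemma ideal_prod_nil : ideal_prod [::] = [set: R].
Proof. by rewrite /ideal_prod big_nil. Qed.

Lemma ideal_prod_cons J s : ideal_prod (J :: s) = ideal_mul J (ideal_prod s).
Proof. by rewrite /ideal_prod big_cons. Qed.

Lemma ideal_mulP I J a b : I a -> J b -> ideal_mul I J (a * b).
Proof.
move=> Ia Jb; exists [:: (a, b)]; last by rewrite big_seq1.
by move=> u; rewrite inE => /eqP ->.
Qed.

Lemma ideal_mul_sub I J K : is_ideal K ->
  (forall a b, I a -> J b -> K (a * b)) -> ideal_mul I J `<=` K.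
Proof.
move=> Kid IJK c [s sIJ ->]; apply: ideal_sum => // u /sIJ[Iu Ju].
exact: IJK.
Qed.

Lemma ideal_prod_sub s J : (forall K, K \in s -> is_ideal K) -> J \in s ->
  ideal_prod s `<=` J.
Proof.
elim: s => // K s IHs sid; rewrite inE ideal_prod_cons => Js.
have Jid : is_ideal J by apply: sid; rewrite inE.
have [_ _ JM] := Jid; apply: ideal_mul_sub => // a b Ka sb.
case/orP: Js => [/eqP JK|Js]; first by rewrite mulrC; apply: JM; rewrite JK.
by apply/JM/(IHs _ Js) => // L Ls; apply: sid; rewrite inE Ls orbT.
Qed.

Lemma ideal_prod_exp s a : (forall J, J \in s -> J a) ->
  ideal_prod s (a ^+ size s).
Proof.
elim: s => [|J s IHs] sa; first by rewrite ideal_prod_nil.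
rewrite ideal_prod_cons exprS; apply: ideal_mulP.
  by apply: sa; rewrite mem_head.
by apply: IHs => K Ks; apply: sa; rewrite inE Ks orbT.
Qed.

Lemma principalM a b :
  ideal_mul (principal a) (principal b) = principal (a * b).
Proof.
apply/seteqP; split.
  apply: ideal_mul_sub; first exact: principal_is_ideal.
  by move=> _ _ [r _ <-] [t _ <-]; exists (r * t); rewrite // mulrACA.
move=> _ [r _ <-]; rewrite mulrA; apply: ideal_mulP; first by exists r.
by exists 1; rewrite ?mul1r.
Qed.

Lemma ideal_prod_principal (s : seq R) :
  ideal_prod [seq principal a | a <- s] = principal (\prod_(a <- s) a).
Proof.
elim: s => [|a s IHs]; first by rewrite ideal_prod_nil big_nil principal1.
by rewrite /= ideal_prod_cons IHs principalM big_cons.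
Qed.

(* [set0] is added to the Zorn family because the empty chain has union set0. *)
Lemma exists_maximal_ideal I : is_proper_ideal I ->
  exists2 M, is_maximal_ideal M & I `<=` M.
Proof.
move=> Ipr.
pose P : set (set R) := [set J | J = set0 \/ is_proper_ideal J /\ I `<=` J].
have [F FP Ftot|M [PM Mmax]] := @Zorn_bigcup R P.
  have [[J0 FJ0 J0n0]|F0] := pselect (exists2 J, F J & J <> set0); last first.
    left; apply/seteqP; split=> // a [J FJ Ja]; exfalso; apply: F0.
    by exists J => //; apply/eqP/set0P; exists a.
  have Fpr J a : F J -> J a -> is_proper_ideal J /\ I `<=` J.
    by move=> FJ Ja; case: (FP _ FJ) => // J0'; rewrite J0' in Ja.
  have [a0 J0a0] : exists a0, J0 a0 by apply/set0P/eqP.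
  have [J0pr IJ0] := Fpr _ _ FJ0 J0a0.
  right; split; last by move=> a Ia; exists J0 => //; exact: IJ0.
  split; last first.
    move=> FT; have [J FJ J1] : (\bigcup_(X in F) X) 1 by rewrite FT.
    by apply: (proper_ideal1 _ J1); have [] := Fpr _ _ FJ J1.
  split.
  - by exists J0 => //; have [[]] := J0pr.
  - move=> a b [J FJ Ja] [K FK Kb].
    have [[[_ JD _] _] _] := Fpr _ _ FJ Ja.
    have [[[_ KD _] _] _] := Fpr _ _ FK Kb.
    case: (Ftot _ _ FJ FK) => [JK|KJ].
      by exists K => //; apply: KD => //; exact: JK.
    by exists J => //; apply: JD => //; exact: KJ.
  - move=> r a [J FJ Ja]; exists J => //.
    by have [[[_ _ JM] _] _] := Fpr _ _ FJ Ja; exact: JM.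
have [Mpr IM] : is_proper_ideal M /\ I `<=` M.
  case: PM => // M0; exfalso; apply: (Mmax I); last by right; split.
  rewrite M0; split=> //; have [[I0 _ _] _] := Ipr.
  by move=> /(_ _ I0).
exists M => //; split=> // J Jpr MJ; apply: contrapT => neqJM.
apply: (Mmax J); last by right; split=> //; exact: subset_trans IM MJ.
by split=> // JM; apply: neqJM; exact/seteqP.
Qed.

End IdealTheory.

(** * Divisibility and maximal ideals in a domain *)

Section Divisibility.
Variable R : idomainType.
Implicit Types (I J M : set R) (a b c g h r : R).

Lemma divides_refl a : divides a a.
Proof. by exists 1; rewrite mul1r. Qed.

Lemma divides_trans b a c : divides a b -> divides b c -> divides a c.
Proof. by move=> [u ->] [v ->]; exists (v * u); rewrite mulrA. Qed.

Lemma divides_mull a b c : divides a b -> divides a (c * b).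
Proof. by move=> [u ->]; exists (c * u); rewrite mulrA. Qed.

Lemma divides_mulr a b c : divides a b -> divides a (b * c).
Proof. by rewrite mulrC; exact: divides_mull. Qed.

Lemma divides_add a b c : divides a b -> divides a c -> divides a (b + c).
Proof. by move=> [u ->] [v ->]; exists (u + v); rewrite mulrDl. Qed.

Lemma divides_mul a b c d : divides a b -> divides c d ->
  divides (a * c) (b * d).
Proof. by move=> [u ->] [v ->]; exists (u * v); rewrite mulrACA. Qed.

Lemma divides_exp a b n : divides a b -> divides (a ^+ n) (b ^+ n).
Proof. by move=> [u ->]; exists (u ^+ n); rewrite exprMn. Qed.

Lemma divides_mulI a b c : c != 0 -> divides (a * c) (b * c) -> divides a b.
Proof.
by move=> c0 [u]; rewrite mulrA => /(mulIf c0) ->; exists u.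
Qed.

Lemma divides_unit a b : divides a b -> b \is a GRing.unit ->
  a \is a GRing.unit.
Proof. by move=> [c ->]; rewrite unitrM => /andP[]. Qed.

Lemma divides1 a : divides a 1 -> a \is a GRing.unit.
Proof. by move=> /divides_unit; apply; exact: unitr1. Qed.

Lemma ideal_divides I a b : is_ideal I -> divides a b -> I a -> I b.
Proof. by move=> [_ _ IM] [c ->]; exact: IM. Qed.

Lemma principal_proper a : is_proper_ideal (principal a) <->
  a \isn't a GRing.unit.
Proof.
split=> [apr|au]; last first.
  split=> [|aT]; first exact: principal_is_ideal.
  have [c _ ca1] : principal a 1 by rewrite aT.
  by case/negP: au; apply: divides1; exists c.
by apply/negP => au; apply: (proper_ideal1 apr); exists a^-1; rewrite ?mulVr.
Qed.

Lemma exists_maximal_at a : a \isn't a GRing.unit ->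
  exists M, maximal_ideals_at a M.
Proof.
move=> /principal_proper/exists_maximal_ideal[M Mmax aM].
by exists M; split=> //; apply: aM; exists 1; rewrite ?mul1r.
Qed.

Lemma maximal_nonunit M a : is_maximal_ideal M -> M a ->
  a \isn't a GRing.unit.
Proof.
move=> [Mpr _] Ma; apply/negP => au; apply: (proper_ideal1 Mpr).
apply: ideal_divides Ma; first by have [] := Mpr.
by exists a^-1; rewrite mulVr.
Qed.

Lemma maximal_mul M a b : is_maximal_ideal M -> M (a * b) -> M a \/ M b.
Proof. by move=> /maximal_prime_ideal[_]; apply. Qed.

Lemma maximal_exp M a n : is_maximal_ideal M -> M (a ^+ n) -> M a.
Proof.
move=> Mmax; elim: n => [|n IHn].
  by rewrite expr0; have [/proper_ideal1] := Mmax.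
by rewrite exprS => /(maximal_mul Mmax)[].
Qed.

Lemma maximal_ideals_atM a b :
  maximal_ideals_at (a * b) = maximal_ideals_at a `|` maximal_ideals_at b.
Proof.
apply/seteqP; split=> M.
  by move=> [Mmax /(maximal_mul Mmax)[]]; [left|right].
have Mid : is_maximal_ideal M -> is_ideal M by move=> [[]].
move=> [|] [Mmax Ma]; split=> //.
  by apply: ideal_divides Ma; [exact: Mid|exact/divides_mulr/divides_refl].
by apply: ideal_divides Ma; [exact: Mid|exact/divides_mull/divides_refl].
Qed.

End Divisibility.
(** * Radical elements of Bezout domains *)

Section RadicalElements.
Variable R : idomainType.
Implicit Types (I J M : set R) (a b c g h r : R).

(** Testing squares is enough: by [radical_elementX] this says that [principal r] is a radical
    ideal. Units and 0 satisfy it as well. *)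
Definition radical_element r := forall b, divides r (b ^+ 2) -> divides r b.

Definition bezout_domain := forall a b, exists g u v,
  [/\ g = u * a + v * b, divides g a & divides g b].

(** Descent on the exponent: b^(n+2) divides (b^(n+1))^2, so radicality lowers n+2 to n+1. For
    exponent 0, [r] divides 1 and hence everything. *)
Lemma radical_elementX r b n : radical_element r -> divides r (b ^+ n) ->
  divides r b.
Proof.
move=> rrad; elim: n b => [|[|n] IHn] b rb; last 2 first.
- by rewrite -[b]expr1.
- apply/IHn/rrad; rewrite -exprM (_ : n.+1 * 2 = n.+2 + n)%N; last first.
    by rewrite muln2 -addnn -addSnnS.
  by rewrite exprD; exact: divides_mulr.
- by rewrite -[b]mulr1; exact: divides_mull.
Qed.

(** If g | b^2, then gh | (bh)^2, so gh | bh, and [h] cancels. *)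
Lemma radical_element_factor g h : h != 0 -> radical_element (g * h) ->
  radical_element g.
Proof.
move=> h0 ghrad b gb; apply: (divides_mulI h0); apply: ghrad.
rewrite exprMn [h ^+ 2]expr2; apply: divides_mul => //.
exact/divides_mulr/divides_refl.
Qed.

Lemma radical_ideal_principal r : radical_element r ->
  is_radical_ideal (principal r).
Proof.
move=> rrad; split; first exact: principal_is_ideal.
apply/seteqP; split; last exact: radical_sub.
move=> b [n [c _ cr]]; have [||d ->] := @radical_elementX r b n => //.
  by exists c.
by exists d.
Qed.

Hypothesis bezoutR : bezout_domain.

(* A common divisor d of g and h satisfies d^2 | gh, hence gh | gh/d. *)
Lemma radical_element_coprime g h : g * h != 0 -> radical_element (g * h) ->
  exists u v, 1 = u * g + v * h.
Proof.
move=> gh0 ghrad; have [d [u [v [dE [g' gE] [h' hE]]]]] := bezoutR g h.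
have d0 : d != 0 by apply: contraNneq gh0 => d0; rewrite gE d0 mulr0 mul0r.
have g'h'd0 : g' * h' * d != 0.
  by move: gh0; rewrite gE hE !mulf_eq0 !negb_or (negPf d0) /= -!andbA.
have : divides (g * h) (g' * h' * d).
  apply: ghrad; exists (g' * h'); rewrite gE hE; ring.
move=> [e eE]; have /divides1 du : divides d 1.
  exists e; apply: (mulIf g'h'd0); rewrite mul1r {1}eE gE hE; ring.
by exists (d^-1 * u), (d^-1 * v); rewrite -!mulrA -mulrDr -dE mulVr.
Qed.

Lemma coprime_divides a b c : (exists u v, 1 = u * a + v * b) ->
  divides a (b * c) -> divides a c.
Proof.
move=> [u [v uv]] abc; rewrite -[c]mul1r uv mulrDl -!mulrA.
apply: divides_add; last exact: divides_mull.
by apply/divides_mull/divides_mulr/divides_refl.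
Qed.

Lemma ideal_comb I a b u v : is_ideal I -> I a -> I b -> I (u * a + v * b).
Proof. by move=> [_ ID IM] Ia Ib; apply: ID; exact: IM. Qed.

(* g = gcd(a, r) plays the role of the radical of a. *)
Lemma divides_gcd_exp a r N g u v : divides a (r ^+ N) -> g = u * a + v * r ->
  divides a (g ^+ N).
Proof.
move=> [c rN] ->; rewrite exprDn big_ord_recr /= subnn expr0 mul1r binn mulr1n.
rewrite exprMn rN mulrA; apply: divides_add; last first.
  exact/divides_mull/divides_refl.
elim/big_ind: _ => [||[i iN] _ /=]; first by exists 0; rewrite mul0r.
  by move=> x y; exact: divides_add.
rewrite -mulr_natl -[(N - i)%N]prednK ?subn_gt0 // exprS.
by apply/divides_mull/divides_mulr/divides_mulr/divides_mull/divides_refl.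
Qed.

(** The peeling step. The gcd [g] of [a] and [r] is radical as a divisor of [r], and cancelling [g]
    in a | g^(N+1) leaves a' | g^N, which divides r^N. The exponent has dropped by one, so an
    induction on [N] can continue with [a']. *)
Lemma radical_layer a r N : a != 0 -> r != 0 -> radical_element r ->
  divides a (r ^+ N.+1) ->
  exists g a', [/\ a = g * a', a' != 0, radical_element g,
    divides a (g ^+ N.+1) & divides a' (r ^+ N)].
Proof.
move=> a0 r0 rrad aN; have [g [u [v [gE [a' aE] [r' rE]]]]] := bezoutR a r.
exists g, a'; rewrite mulrC; have g0 : g != 0.
  by apply: contraNneq a0 => g0; rewrite aE g0 mulr0.
have a'0 : a' != 0 by apply: contraNneq a0 => a'0; rewrite aE a'0 mul0r.
have r'0 : r' != 0 by apply: contraNneq r0 => r'0; rewrite rE r'0 mul0r.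
split=> //; first by apply: (radical_element_factor r'0); rewrite mulrC -rE.
  exact: divides_gcd_exp aN gE.
apply: (divides_mulI g0); rewrite -aE.
have [c cE] := divides_gcd_exp aN gE.
have : divides a (g * g ^+ N) by rewrite -exprS cE; exists c.
move=> /divides_trans; apply; rewrite mulrC; apply: divides_mul.
  by apply: divides_exp; exists r'.
exact: divides_refl.
Qed.

Definition radically_bounded := forall a, a != 0 ->
  exists r N, [/\ r != 0, radical_element r & divides a (r ^+ N)].

Hypothesis boundR : radically_bounded.

Lemma radical_factorization a : a != 0 -> exists u (s : seq R),
  [/\ u \is a GRing.unit, forall r, r \in s -> radical_element r &
      a = u * \prod_(r <- s) r].
Proof.
move=> a0; have [r [N [r0 rrad]]] := boundR a0.
elim: N a a0 => [|N IHN] a a0 aN.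
  by exists a, [::]; rewrite big_nil mulr1; split=> //; exact: divides1.
have [g [a' [-> a'0 grad _ /(IHN _ a'0)]]] := radical_layer a0 r0 rrad aN.
move=> [u [s [uu srad ->]]]; exists u, (g :: s); split=> //.
  by move=> t; rewrite inE => /orP[/eqP->|/srad].
by rewrite big_cons mulrCA.
Qed.

Lemma unit_radical u : u \is a GRing.unit -> radical_element u.
Proof. by move=> uu b _; exists (b / u); rewrite divrK. Qed.

(** * Factorization into radical ideals *)

Lemma radical_principal_factorization (I : set R) : is_principal_ideal I ->
  exists2 s : seq (set R),
    (forall J, J \in s -> is_radical_ideal J /\ is_principal_ideal J)
    & I = ideal_prod s.
Proof.
move=> [a ->].
have sprin (s : seq R) : (forall r, r \in s -> radical_element r) ->
    forall J, J \in [seq principal r | r <- s] ->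
    is_radical_ideal J /\ is_principal_ideal J.
  move=> srad J /mapP[r /srad rrad ->]; split; last by exists r.
  exact: radical_ideal_principal.
have [->|a0] := eqVneq a 0.
  (* The zero ideal of a domain is radical, so it is its own factorization. *)
  exists [seq principal r | r <- [:: 0]]; last first.
    by rewrite ideal_prod_principal big_seq1.
  apply: sprin => r; rewrite inE => /eqP -> b [c]; rewrite mulr0 => /eqP.
  by rewrite expf_eq0 => /eqP ->; exact: divides_refl.
have [u [s [uu srad aE]]] := radical_factorization a0.
exists [seq principal r | r <- u :: s]; last first.
  by rewrite ideal_prod_principal big_cons aE.
apply: sprin => r; rewrite inE => /orP[/eqP->|/srad //].
exact: unit_radical.
Qed.

Definition colon I J : set R := [set c | forall d, J d -> I (c * d)].

Lemma colon_is_ideal I J : is_ideal I -> is_ideal (colon I J).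
Proof.
move=> [I0 ID IM]; split.
- by move=> d _; rewrite mul0r.
- by move=> a b Ja Jb d Jd; rewrite mulrDl; apply: ID; [exact: Ja|exact: Jb].
- by move=> r a Ja d Jd; rewrite -mulrA; apply: IM; exact: Ja.
Qed.

(** Here [g] is the radical of [a] and a' = a/g. For d^k in I, let h = gcd(a, d^k), which lies in I,
    write a = c h, and let [h1] be the radical of [h]. Then h1 | d^k gives h1 | d. Moreover a = c h
    divides (h1 c)^(N+1), so g | h1 c. Hence a' d = (h1 c / g) (d / h1) h lies in I. *)
Lemma colon_radical I a r N g a' : is_ideal I -> I a -> a != 0 ->
  r != 0 -> radical_element r -> divides a (r ^+ N.+1) ->
  radical_element g -> a = g * a' -> divides a (g ^+ N.+1) ->
  colon I (radical I) a'.
Proof.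
move=> Iid Ia a0 r0 rrad aN grad aE ag d [k Idk].
have [h [u [v [hE [c ac] hd]]]] := bezoutR a (d ^+ k).
have h0 : h != 0 by apply: contraNneq a0 => h0; rewrite ac h0 mulr0.
have Ih : I h by rewrite hE; exact: ideal_comb.
have hN : divides h (r ^+ N.+1) by apply: divides_trans aN; exists c.
have [h1 [h' [hh' h'0 h1rad hh1 _]]] := radical_layer h0 r0 rrad hN.
have [e dE] : divides h1 d.
  apply: (radical_elementX h1rad (n := k)); apply: divides_trans hd.
  by exists h'; rewrite hh' mulrC.
have [w wE] : divides g (h1 * c).
  apply: (radical_elementX grad (n := N.+1)).
  apply: (@divides_trans _ a); first by exists a'; rewrite aE mulrC.
  rewrite ac exprMn mulrC; apply: divides_mul => //; rewrite exprSr.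
  exact/divides_mull/divides_refl.
have g0 : g != 0 by apply: contraNneq a0 => g0; rewrite aE g0 mul0r.
have -> : a' = h' * w.
  by apply: (mulIf g0); rewrite mulrC -aE ac -mulrA -wE hh'; ring.
have -> : h' * w * d = w * e * h by rewrite dE hh'; ring.
by have [_ _ IM] := Iid; exact: IM.
Qed.

Lemma radical_ideal_factorization N I a r : is_ideal I -> I a -> a != 0 ->
  r != 0 -> radical_element r -> divides a (r ^+ N) ->
  exists2 s : seq (set R),
    (forall J, J \in s -> is_radical_ideal J) & I = ideal_prod s.
Proof.
move=> + + + r0 rrad; elim: N I a => [|N IHN] I a Iid Ia a0 aN.
  exists [::] => //; rewrite ideal_prod_nil; apply: ideal_setT => //.
  by move: Ia; apply: ideal_divides.
pose J := colon I (radical I).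
have [g [a' [aE a'0 grad ag a'N]]] := radical_layer a0 r0 rrad aN.
have Ja' : J a' by apply: (colon_radical Iid Ia a0 r0 rrad aN grad aE ag).
have [s srad Js] := IHN _ _ (colon_is_ideal (radical I) Iid) Ja' a'0 a'N.
exists (radical I :: s).
  by move=> K; rewrite inE => /orP[/eqP->|/srad //]; exact: radical_is_radical.
rewrite ideal_prod_cons -Js; apply/seteqP; split; last first.
  apply: ideal_mul_sub => // b c Ib Jc; rewrite mulrC; exact: Jc.
(* The element [b] itself need not divide a power of [r], but h = gcd(a, b) is again in I and does.
   Splitting h = h1 h' puts [h1] in rad(I), and [colon_radical] for [h] puts [h'] in (I :
   rad(I)). *)
move=> b Ib; have [h [u [v [hE [c ac] [d bd]]]]] := bezoutR a b.
have h0 : h != 0 by apply: contraNneq a0 => h0; rewrite ac h0 mulr0.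
have Ih : I h by rewrite hE; exact: ideal_comb.
have hN : divides h (r ^+ N.+1) by apply: divides_trans aN; exists c.
have [h1 [h' [hh' h'0 h1rad hh1 _]]] := radical_layer h0 r0 rrad hN.
have -> : b = h1 * (d * h') by rewrite bd hh'; ring.
apply: ideal_mulP.
  by exists N.+1; apply: ideal_divides hh1 Ih.
have [_ _ JM] := colon_is_ideal (radical I) Iid; apply: JM.
exact: (colon_radical Iid Ih h0 r0 rrad hN h1rad hh' hh1).
Qed.

Lemma bezout_sp_domain : sp_domain R.
Proof.
move=> I [Iid _]; have [[a Ia a0]|I0] := pselect (exists2 a, I a & a != 0).
  have [r [N [r0 rrad aN]]] := boundR a0.
  exact: radical_ideal_factorization Iid Ia a0 r0 rrad aN.
have -> : I = principal 0.
  apply/seteqP; split=> [a Ia|_ [c _ <-]]; last first.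
    by rewrite mulr0; have [] := Iid.
  exists 0 => //; rewrite mulr0; apply/esym/eqP; apply: contra_notT I0 => a0.
  by exists a.
have [|s srad sE] := @radical_principal_factorization (principal 0).
  by exists 0.
by exists s => // J /srad[].
Qed.

(** * Radical elements at maximal ideals, and prime factorizations *)

Lemma maximal_radical_split M g h : is_maximal_ideal M ->
  g * h != 0 -> radical_element (g * h) -> M g -> ~ M h.
Proof.
move=> Mmax gh0 ghrad Mg Mh.
have [u [v uv]] := radical_element_coprime gh0 ghrad.
have [Mpr _] := Mmax; apply: (proper_ideal1 Mpr); rewrite uv.
by apply: ideal_comb => //; have [] := Mpr.
Qed.

(** Each radical factor c of [b] lying in M counts as one power of [r]: d = gcd(c, r) lies in M, so
    the cofactors c/d and r/d avoid M because c and r are radical. With denominators cleared, this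
    is b = unit * r^k in the localization at M. *)
Lemma maximal_uniformizer M r : is_maximal_ideal M -> M r -> r != 0 ->
  radical_element r -> forall b, b != 0 ->
  exists k t u, [/\ ~ M t, ~ M u & t * b = u * r ^+ k].
Proof.
move=> Mmax Mr r0 rrad b b0; have [Mpr _] := Mmax.
have Mid : is_ideal M by have [] := Mpr.
have nM1 := proper_ideal1 Mpr.
have nMM x y : ~ M x -> ~ M y -> ~ M (x * y).
  by move=> nx ny /(maximal_mul Mmax)[].
have [w [s [wu srad bE]]] := radical_factorization b0.
rewrite {}bE in b0 *; elim: s srad b0 => [|c s IHs] srad.
  move=> _; exists 0%N, 1, w; rewrite big_nil mul1r expr0.
  by split=> // /(maximal_nonunit Mmax)/negP.
rewrite big_cons mulrCA mulf_eq0 negb_or => /andP[c0 /IHs].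
case=> [t ts|k [t [u [nMt nMu tuE]]]]; first by apply: srad; rewrite inE ts orbT.
have crad : radical_element c by apply: srad; rewrite mem_head.
have [Mc|nMc] := pselect (M c); last first.
  exists k, t, (c * u); split=> //; first exact: nMM.
  by rewrite [LHS]mulrCA tuE mulrA.
have [d [x [y [dE [c' cE] [r' rE]]]]] := bezoutR c r.
have Md : M d by rewrite dE; exact: ideal_comb.
have nMc' : ~ M c'.
  by apply: (@maximal_radical_split M d c'); rewrite // mulrC -cE.
have nMr' : ~ M r'.
  by apply: (@maximal_radical_split M d r'); rewrite // mulrC -rE.
exists k.+1, (r' * t), (c' * u); split; [exact: nMM|exact: nMM|].
rewrite cE mulrACA [r' * _]mulrCA -rE tuE exprS; ring.
Qed.

(** If r | ab divides neither [a] nor [b], split off g = gcd(r, a). Were [g] a unit, [r] would be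
    coprime to [a] and divide [b]; were r/g a unit, [r] would divide [a]. *)
Lemma split_nonprime_radical r : r != 0 -> r \isn't a GRing.unit ->
  radical_element r -> ~ is_prime_element r ->
  exists g h, [/\ r = g * h, g \isn't a GRing.unit & h \isn't a GRing.unit].
Proof.
move=> r0 ru rrad nprime.
have [a [b [rab ra rb]]] : exists a b,
    [/\ divides r (a * b), ~ divides r a & ~ divides r b].
  apply: contrapT => nab; apply: nprime; split=> // a b rab.
  have [|ra] := pselect (divides r a); first by left.
  by right; apply: contrapT => rb; apply: nab; exists a, b.
have [g [u [v [gE [r' rE] [a' aE]]]]] := bezoutR r a.
exists g, r'; rewrite [g * _]mulrC; split=> //; apply/negP => xu.
  apply: rb; apply: (@coprime_divides r a b) => //.
  by exists (g^-1 * u), (g^-1 * v); rewrite -!mulrA -mulrDr -gE mulVr.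
by apply: ra; exists (a' / r'); rewrite rE mulrA divrK.
Qed.

(** Induction on a bound for the number of maximal ideals containing [r]. If r = xy with [y] a
    nonunit, some maximal ideal contains [y]; it cannot contain [x], so it can be removed from the
    list that serves for [x]. *)
Lemma radical_prime_factorization (n : nat) (s : seq (set R)) r :
  (size s <= n)%N -> maximal_ideals_at r `<=` [set` s] ->
  r != 0 -> radical_element r ->
  exists u (t : seq R), [/\ u \is a GRing.unit,
    forall p, p \in t -> is_prime_element p & r = u * \prod_(p <- t) p].
Proof.
elim: n s r => [|n IHn] s r sn rs r0 rrad.
  exists r, [::]; rewrite big_nil mulr1; split=> //; apply: contrapT => /negP.
  move=> /exists_maximal_at[M /rs /=]; move: sn; rewrite leqn0 size_eq0.
  by move=> /eqP ->.
have [ru|ru] := boolP (r \is a GRing.unit).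
  by exists r, [::]; rewrite big_nil mulr1.
have [rp|rnp] := pselect (is_prime_element r).
  exists 1, [:: r]; rewrite big_seq1 mul1r; split=> //; first exact: unitr1.
  by move=> p; rewrite inE => /eqP ->.
have [g [h [rE gu hu]]] := split_nonprime_radical r0 ru rrad rnp.
have sub x y : r = x * y -> y \isn't a GRing.unit ->
    exists u (t : seq R), [/\ u \is a GRing.unit,
      forall p, p \in t -> is_prime_element p & x = u * \prod_(p <- t) p].
  move=> {rE g h gu hu} rE yu; have [M [Mmax My]] := exists_maximal_at yu.
  rewrite {}rE in r0 rs rrad.
  have [x0 y0] : x != 0 /\ y != 0.
    by move: r0; rewrite mulf_eq0 negb_or => /andP[].
  have Ms : M \in s by apply: rs; rewrite maximal_ideals_atM; right.
  apply: (IHn (rem M s)).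
  - by rewrite size_rem //; case: (size s) sn.
  - move=> K [Kmax Kx]; 
    have : K \in s by apply: rs; rewrite maximal_ideals_atM; left.
    rewrite (perm_mem (perm_to_rem Ms)) inE => /orP[/eqP KM|//].
    exfalso; rewrite {}KM in Kx.
    exact: (maximal_radical_split Mmax r0 rrad Kx).
  - exact: x0.
  - exact: radical_element_factor rrad.
have [u [t [uu tp gE]]] := sub _ _ rE hu.
have [u' [t' [uu' tp' hE]]] : exists u (t : seq R), [/\ u \is a GRing.unit,
    forall p, p \in t -> is_prime_element p & h = u * \prod_(p <- t) p].
  by apply: (sub h g) => //; rewrite mulrC.
exists (u * u'), (t ++ t'); split; first by rewrite unitrM uu.
  by move=> p; rewrite mem_cat => /orP[/tp|/tp'].
by rewrite big_cat /= rE gE hE mulrACA.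
Qed.

Lemma prime_element_unit (u p : R) : u \is a GRing.unit -> is_prime_element p ->
  is_prime_element (u * p).
Proof.
move=> uu [p0 pu pP].
have upE b : divides (u * p) b <-> divides p b.
  split=> [[c ->]|[c ->]]; first by exists (c * u); rewrite mulrA.
  by exists (c / u); rewrite mulrA divrK.
split.
- by rewrite mulf_neq0 //; apply: contraTneq uu => ->; rewrite unitr0.
- by rewrite unitrM uu.
- by move=> a b /upE/pP[] /upE; [left|right].
Qed.

Lemma finite_maximal_prime_product a : a != 0 -> a \isn't a GRing.unit ->
  finite_set (maximal_ideals_at a) -> prime_product a.
Proof.
move=> a0 au /finite_seqP[S aS]; have [w [s [wu srad aE]]] := radical_factorization a0.
have [u [t [uu tp {}aE]]] : exists u (t : seq R), [/\ u \is a GRing.unit,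
    forall p, p \in t -> is_prime_element p & a = u * \prod_(p <- t) p].
  have {}aS : maximal_ideals_at a `<=` [set` S] by rewrite aS.
  rewrite {}aE {au} in a0 aS *; elim: s srad a0 aS => [|r s IHs] srad.
    by exists w, [::]; rewrite big_nil.
  rewrite big_cons mulrCA mulf_eq0 negb_or maximal_ideals_atM subUset.
  move=> /andP[r0 sr0] [rS sS].
  have [|u [t [uu tp ->]]] := IHs _ sr0 sS.
    by move=> x xs; apply: srad; rewrite inE xs orbT.
  have [|u' [t' [uu' tp' ->]]] := radical_prime_factorization (leqnn _) rS r0.
    by apply: srad; rewrite mem_head.
  exists (u' * u), (t' ++ t); split; first by rewrite unitrM uu'.
    by move=> p; rewrite mem_cat => /orP[/tp'|/tp].
  by rewrite big_cat /= mulrACA.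
(* [prime_product] leaves no room for a unit factor, so [u] is absorbed into the first prime, which
   exists because [a] is a nonunit. *)
case: t tp aE => [|p t] tp aE; first by rewrite aE big_nil mulr1 uu in au.
exists (u * p :: t); last by rewrite aE !big_cons mulrA.
move=> q; rewrite inE => /orP[/eqP ->|qt]; last by apply: tp; rewrite inE qt orbT.
by apply: prime_element_unit => //; apply: tp; rewrite mem_head.
Qed.

End RadicalElements.
(** * Localizations *)

Section SubringVal.
Variables (K : fieldType) (S : subring K).

(** The inclusion into [K], under a name of its own that carries the ring morphism structure. *)
Definition subring_val (a : subring_dom S) : K := val a.

Fact subring_val_zmod_morphism : zmod_morphism subring_val.
Proof. exact: raddfB. Qed.

Fact subring_val_monoid_morphism : monoid_morphism subring_val.
Proof. by split; [exact: rmorph1|exact: rmorphM]. Qed.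

HB.instance Definition _ :=
  GRing.isZmodMorphism.Build _ _ subring_val subring_val_zmod_morphism.
HB.instance Definition _ :=
  GRing.isMonoidMorphism.Build _ _ subring_val subring_val_monoid_morphism.

Lemma subring_val_inj : injective subring_val.
Proof. exact: val_inj. Qed.

Lemma subring_valP (a : subring_dom S) : (S : set K) (subring_val a).
Proof. exact: (set_mem (valP a)). Qed.

Lemma subring_val_surj y : (S : set K) y ->
  exists a : subring_dom S, subring_val a = y.
Proof. by move=> Sy; exists (Sub y (mem_set Sy)); exact: SubK. Qed.

End SubringVal.

Section Localization.
Variables (R : idomainType) (P : set R) (primeP : is_prime_ideal P).
Let S := localization primeP.
Implicit Types (a b c r : R) (y z : S).

Lemma prime_ideal0 : P 0.
Proof. by have [[[]]] := primeP. Qed.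

Lemma prime_ideal1 : ~ P 1.
Proof. by have [/proper_ideal1] := primeP. Qed.

Lemma prime_idealM_notin a b : ~ P a -> ~ P b -> ~ P (a * b).
Proof. by move=> na nb; have [_ /[apply] -[]] := primeP. Qed.

Lemma tofrac_notin_neq0 b : ~ P b -> tofrac b != 0.
Proof.
move=> nPb; rewrite tofrac_eq0; apply: contra_notN nPb => /eqP ->.
exact: prime_ideal0.
Qed.

Lemma localizationP z : exists a b, ~ P b /\ subring_val z = tofrac a / tofrac b.
Proof. exact: (@subring_valP _ (Subring (localization_subring primeP))). Qed.

Lemma localization_frac a b : ~ P b -> exists z, subring_val z = tofrac a / tofrac b.
Proof.
move=> nPb; have ab : localization_set P (tofrac a / tofrac b) by exists a, b.
exact: (@subring_val_surj _ (Subring (localization_subring primeP))).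
Qed.

Lemma localization_embed a : exists z, subring_val z = tofrac a.
Proof.
have [z zE] := localization_frac a prime_ideal1.
by exists z; rewrite zE tofrac1 divr1.
Qed.

Lemma localization_nonunit r y : P r -> subring_val y = tofrac r ->
  y \isn't a GRing.unit.
Proof.
move=> Pr yE; apply/negP => yu.
have [a [b [nPb yVE]]] := localizationP y^-1.
have : subring_val (y^-1 * y) = 1 by rewrite mulVr.
rewrite rmorphM /= yVE yE mulrAC -tofracM => /(canRL (divfK (tofrac_notin_neq0 nPb))).
rewrite mul1r => /eqP; rewrite tofrac_eq => /eqP bE; apply: nPb.
by rewrite -bE; have [[[_ _ PM] _] _] := primeP; exact: PM.
Qed.

Lemma localization_valuation r y : r != 0 -> subring_val y = tofrac r ->
  (forall b, b != 0 -> exists k t u, [/\ ~ P t, ~ P u & t * b = u * r ^+ k]) ->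
  forall z, z != 0 -> exists k w, w \is a GRing.unit /\ z = w * y ^+ k.
Proof.
move=> r0 yE vr z z0; have [a [b [nPb zE]]] := localizationP z.
have b0 := tofrac_notin_neq0 nPb.
have a0 : a != 0.
  apply: contraNneq z0 => a0; apply/eqP/subring_val_inj.
  by rewrite zE a0 tofrac0 mul0r rmorph0.
have [k [t [u [nPt nPu tuE]]]] := vr _ a0; exists k.
have [t0 u0] := (tofrac_notin_neq0 nPt, tofrac_notin_neq0 nPu).
(* From z = a/b and t a = u r^k the unit is w = u/(t b), with inverse (t b)/u. *)
have [w wE] := localization_frac u (prime_idealM_notin nPt nPb).
have [w' wE'] := localization_frac (t * b) nPu.
have tb0 := tofrac_notin_neq0 (prime_idealM_notin nPt nPb).
exists w; split.
  apply/divides1; exists w'; apply: subring_val_inj.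
  by rewrite rmorph1 rmorphM /= wE wE' mulrA (divfK u0) (divff tb0).
apply: subring_val_inj; rewrite zE rmorphM rmorphXn /= wE yE -tofracXn.
by rewrite mulrAC -tofracM -tuE !tofracM -mulf_div (divff t0) mul1r.
Qed.

Lemma localization_dvr r : P r -> r != 0 ->
  (forall b, b != 0 -> exists k t u, [/\ ~ P t, ~ P u & t * b = u * r ^+ k]) ->
  is_dvr S.
Proof.
move=> Pr r0 vr; have [y yE] := localization_embed r.
have yu := localization_nonunit Pr yE.
have y0 : y != 0.
  by rewrite -(inj_eq (@subring_val_inj _ _)) yE rmorph0 tofrac_eq0.
have vy := localization_valuation r0 yE vr.
have Jy J : is_proper_ideal J -> J `<=` principal y.
  move=> Jpr z Jz; have [->|z0] := eqVneq z 0; first by exists 0; rewrite ?mul0r.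
  have [[|k] [w [wu zE]]] := vy _ z0; last first.
    by exists (w * y ^+ k) => //; rewrite zE exprSr mulrA.
  exfalso; apply: (proper_ideal1 Jpr); apply: ideal_divides Jz.
    by have [] := Jpr.
  by exists w^-1; rewrite zE expr0 mulr1 mulVr.
have ypr : is_proper_ideal (principal y) by exact/principal_proper.
have ymax : is_maximal_ideal (principal y).
  by split=> // J Jpr yJ; apply/seteqP; split=> //; exact: Jy.
split; last by exists y.
  (* The least power of [y] in I generates I; if I contains no power of [y], it is zero, since every
     nonzero element is a unit times such a power. *)
  move=> I Iid; have [Iy|Iy] := pselect (exists k, `[< I (y ^+ k) >]); last first.
    exists 0; apply/seteqP; split=> [z Iz|_ [c _ <-]]; last first.
      by rewrite mulr0; have [] := Iid.
    exists 0; rewrite // mulr0; apply/esym/eqP; apply: contra_notT Iy => z0.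
    have [k [w [wu zE]]] := vy _ z0; exists k; apply/asboolP.
    by apply: ideal_divides Iz => //; exists w^-1; rewrite zE mulKr.
  case: (ex_minnP Iy) => k /asboolP Ik kmin; exists (y ^+ k).
  apply/seteqP; split=> [z Iz|_ [c _ <-]]; last first.
    by have [_ _ IM] := Iid; exact: IM.
  have [->|z0] := eqVneq z 0; first by exists 0; rewrite ?mul0r.
  have [j [w [wu zE]]] := vy _ z0.
  have kj : (k <= j)%N.
    apply/kmin/asboolP; apply: ideal_divides Iz => //.
    by exists w^-1; rewrite zE mulKr.
  by exists (w * y ^+ (j - k)) => //; rewrite -mulrA -exprD subnK.
exists (principal y); split=> // J [Jpr Jmax].
by apply: Jmax => //; exact: Jy.
Qed.

(* The ideal generated by all x_n in the localization would be generated by a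
   single x_n = x_(n+1)^2, making x_(n+1) a unit. *)
Lemma localization_root_chain (x : nat -> R) : (forall n, P (x n)) ->
  (forall n, x n != 0) -> (forall n, x n.+1 ^+ 2 = x n) -> ~ is_dvr S.
Proof.
move=> Px x0 xS [pid _ _].
have /choice[y yE] n : exists z, subring_val z = tofrac (x n).
  exact: localization_embed.
have yS n : y n.+1 ^+ 2 = y n.
  by apply: subring_val_inj; rewrite rmorphXn /= !yE -tofracXn xS.
have mono m n : (m <= n)%N -> divides (y n) (y m).
  move=> /subnK <-; elim: (n - m)%N => [|k IHk]; first exact: divides_refl.
  apply: divides_trans IHk; rewrite -[in X in divides _ X]yS expr2.
  exact/divides_mulr/divides_refl.
pose I : set S := [set z | exists n, divides (y n) z].
have Iid : is_ideal I.
  split; first by exists 0%N, 0; rewrite mul0r.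
  - move=> a b [m am] [n bn]; exists (maxn m n); apply: divides_add.
      exact: divides_trans (mono _ _ (leq_maxl m n)) am.
    exact: divides_trans (mono _ _ (leq_maxr m n)) bn.
  - by move=> r a [n an]; exists n; exact: divides_mull.
have [g IE] := pid _ Iid.
have [n [c gE]] : I g by rewrite IE; exists 1; rewrite ?mul1r.
have [d _ yg] : principal g (y n.+1).
  by rewrite -IE; exists n.+1; exact: divides_refl.
case/negP: (localization_nonunit (Px n.+1) (yE n.+1)).
apply: divides1; exists (d * c); apply: (mulIf (_ : y n.+1 != 0)).
  by rewrite -(inj_eq (@subring_val_inj _ _)) yE rmorph0 tofrac_eq0.
by rewrite mul1r -[RHS](mulrA (d * c)) -expr2 yS -[RHS]mulrA -gE yg.
Qed.

End Localization.

Lemma bezout_almost_dedekind (R : idomainType) :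
  bezout_domain R -> radically_bounded R ->
  (exists a : R, a != 0 /\ a \isn't a GRing.unit) -> almost_dedekind R.
Proof.
move=> bezoutR boundR [c [c0 cu]] M Mmax.
have [Mpr Mmax'] := Mmax; have [Mid _] := Mpr.
(* If M were zero, it would lie in a maximal ideal [N] containing [c], hence equal [N] by
   maximality, and contain [c] after all. *)
have [a Ma a0] : exists2 a, M a & a != 0.
  apply: contrapT => M0; have [N [Nmax Nc]] := exists_maximal_at cu.
  apply: (M0); exists c => //; rewrite -(Mmax' N) //; first by have [] := Nmax.
  move=> a Ma; have [->|a0] := eqVneq a 0; last by exfalso; apply: (M0); exists a.
  by have [[[]]] := Nmax.
have [r [N [r0 rrad aN]]] := boundR a a0.
have Mr : M r by apply: (maximal_exp (n := N)) => //; apply: ideal_divides aN Ma.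
exact: localization_dvr Mr r0 (maximal_uniformizer bezoutR boundR Mmax Mr r0 rrad).
Qed.
(** * Infinite chains of square roots *)

Section RootChain.
Variables (R : idomainType) (y : nat -> R).
Hypotheses (yS : forall n, y n.+1 ^+ 2 = y n)
  (y0 : forall n, y n != 0) (yu : forall n, y n \isn't a GRing.unit).

Lemma root_chain_exp n : y n ^+ (2 ^ n) = y 0%N.
Proof.
elim: n => [|n IHn]; first by rewrite expn0 expr1.
by rewrite expnS exprM yS.
Qed.

(** Since y_0 = y_k^(2^k) and 2^k > k, such a divisibility would make [y k] a unit. Factorizations
    of y_0 are refuted by taking k to be the number of factors. *)
Lemma root_chain_not_divides k : ~ divides (y 0%N) (y k ^+ k).
Proof.
rewrite -(root_chain_exp k) => -[c].
have k2 : (k < 2 ^ k)%N by rewrite ltn_expl.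
rewrite -(subnK (ltnW k2)) exprD mulrA -[LHS]mul1r => /mulIf.
move=> /(_ (expf_neq0 _ (y0 k))) cE; case/negP: (yu k).
apply: divides1; exists (c * y k ^+ (2 ^ k - k).-1).
by rewrite -mulrA -exprSr prednK // subn_gt0.
Qed.

(** With k primes in the product, each of them divides y_0 = y_k^(2^k) and hence y_k, so y_0 would
    divide y_k^k. *)
Lemma root_chain_not_prime_product : ~ prime_product (y 0%N).
Proof.
move=> [s sp yE]; apply: (@root_chain_not_divides (size s)); rewrite yE.
move: (y (size s)) (root_chain_exp (size s)) => z zE.
have {}sp p : p \in s -> divides p z.
  move=> ps; have [_ pu pP] := sp _ ps.
  have : divides p (z ^+ (2 ^ size s)).
    rewrite zE yE (big_rem p) //=; exact/divides_mulr/divides_refl.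
  elim: (2 ^ size s)%N => [|n IHn]; last by rewrite exprS => /pP[].
  by move=> /divides1; rewrite (negPf pu).
elim: s sp {yE zE} => [|p s IHs] sp; first by rewrite big_nil; exists 1; rewrite mulr1.
rewrite big_cons exprS; apply: divides_mul; first by apply: sp; rewrite mem_head.
by apply: IHs => q qs; apply: sp; rewrite inE qs orbT.
Qed.

(** With k factors, each contains y_0 = y_k^(2^k) and, being radical, y_k, so the product contains
    y_k^k. *)
Lemma root_chain_not_radical_product s :
  (forall J, J \in s -> is_radical_ideal J) -> principal (y 0%N) <> ideal_prod s.
Proof.
move=> srad yE; apply: (@root_chain_not_divides (size s)).
have : ideal_prod s (y (size s) ^+ size s).
  apply: ideal_prod_exp => J Js; have [_ <-] := srad _ Js.
  exists (2 ^ size s)%N; rewrite root_chain_exp.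
  apply: (ideal_prod_sub _ Js); first by move=> K /srad[].
  by rewrite -yE; exists 1; rewrite ?mul1r.
by rewrite -yE => -[c _ <-]; exists c.
Qed.

Lemma root_chain_not_almost_dedekind : ~ almost_dedekind R.
Proof.
move=> Rad; have [M [Mmax My]] := exists_maximal_at (yu 0%N).
apply: (localization_root_chain (x := y) _ y0 yS (Rad M Mmax)) => n.
by apply: (maximal_exp (n := (2 ^ n)%N)) => //; rewrite root_chain_exp.
Qed.

End RootChain.

(** * Polynomials in one variable over a field *)

Section PolyTheory.
Variable F : fieldType.
Implicit Types f g h p q r : {poly F}.

Lemma bezout_poly : bezout_domain {poly F}.
Proof.
move=> f g; have [u uE] := Bezoutp f g.
exists (u.1 * f + u.2 * g), u.1, u.2; split=> //.
  by apply/dvdpP; rewrite (eqp_dvdl _ uE) dvdp_gcdl.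
by apply/dvdpP; rewrite (eqp_dvdl _ uE) dvdp_gcdr.
Qed.

(* If f is not radical, say f divides g^2 but not g, then f divides the square
   of its proper divisor gcd(f, g). *)
Lemma radically_bounded_poly : radically_bounded {poly F}.
Proof.
move=> f; have [n] := ubnP (size f); elim: n f => // n IHn f /ltnSE fn f0.
have [frad|] := pselect (radical_element f).
  by exists f, 1%N; split=> //; rewrite expr1; exact: divides_refl.
move=> /existsNP[g /not_implyP[fg2 nfg]].
have [h [u [v [hE hf [w hg]]]]] := bezout_poly f g.
have h0 : h != 0.
  by have [c fE] := hf; apply: contraNneq f0 => h0; rewrite fE h0 mulr0.
have hn : (size h < n)%N.
  apply: leq_trans fn; have /dvdpP hfd := hf.
  rewrite ltn_neqAle dvdp_leq // andbT dvdp_size_eqp //; apply/negP => hEf.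
  by apply: nfg; apply/dvdpP; rewrite -(eqp_dvdl _ hEf); apply/dvdpP; exists w.
have [r [N [r0 rrad hN]]] := IHn _ hn h0.
exists r, (N * 2)%N; split=> //; rewrite exprM.
apply: divides_trans (divides_exp 2 hN).
have -> : h ^+ 2 = (u ^+ 2 * f + 2 * u * v * g) * f + v ^+ 2 * g ^+ 2.
  by rewrite hE; ring.
by apply: divides_add; [exact/divides_mull/divides_refl|exact: divides_mull].
Qed.

Lemma even_poly_compX2 p : even_poly (p \Po 'X^2) = p.
Proof.
apply/polyP => i; rewrite coef_even_poly coef_comp_poly_Xn //.
by rewrite -muln2 dvdn_mull // mulnK.
Qed.

Lemma odd_poly_compX2 p : odd_poly (p \Po 'X^2) = 0.
Proof.
apply/polyP => i; rewrite coef_odd_poly coef_comp_poly_Xn // coef0.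
by rewrite dvdn2 /= odd_double.
Qed.

(** Even and odd coefficients separate the summands of F[Y] = F[Y^2] + F[Y^2] Y. This is the source
    of the independence of 1 and X^(1/2^(n+1)) over D_n in [level_indep]. *)
Lemma poly_even_odd_eq0 p q : p \Po 'X^2 + (q \Po 'X^2) * 'X = 0 ->
  p = 0 /\ q = 0.
Proof.
move=> pq0; split.
  have := congr1 (@even_poly F) pq0.
  rewrite even_polyD even_polyMX even_poly_compX2 odd_poly_compX2.
  by rewrite mul0r addr0 linear0.
have := congr1 (@odd_poly F) pq0.
by rewrite odd_polyD odd_polyMX even_poly_compX2 odd_poly_compX2 add0r linear0.
Qed.

End PolyTheory.

(** * The ring D *)

Section DyadicLaurentTheory.
Variables (F L : fieldType) (iota : {rmorphism F -> L}) (x : nat -> L).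
Hypotheses (x0_transcendental : ~ algebraicOver iota (x 0%N))
  (xS : forall n, x n.+1 ^+ 2 = x n).
Let D := dyadic_laurent iota xS.

Definition dyadic_val : D -> L := @subring_val _ _.
HB.instance Definition _ := GRing.RMorphism.on dyadic_val.

Lemma dyadic_val_inj : injective dyadic_val.
Proof. exact: subring_val_inj. Qed.

Lemma x_transcendental n : ~ algebraicOver iota (x n).
Proof.
elim: n => [//|n IHn] xn; apply: IHn; rewrite -xS expr2.
exact: algebraic_mul.
Qed.

Lemma x_neq0 n : x n != 0.
Proof.
apply/negP => /eqP xn0; apply: (@x_transcendental n); rewrite xn0.
exact: algebraic0.
Qed.

Definition eval_root n : {poly F} -> L := horner_eval (x n) \o map_poly iota.
HB.instance Definition _ n := GRing.RMorphism.on (eval_root n).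

Lemma eval_rootC n c : eval_root n c%:P = iota c.
Proof. by rewrite /eval_root /= map_polyC /= horner_evalE hornerC. Qed.

Lemma eval_rootX n : eval_root n 'X = x n.
Proof. by rewrite /eval_root /= map_polyX horner_evalE hornerX. Qed.

Lemma eval_root_inj n : injective (eval_root n).
Proof.
apply: raddf_inj => p pn; apply/eqP/negP => /negP p0.
apply: (@x_transcendental n); exists p => //; apply/rootP.
exact: pn.
Qed.

Lemma eval_root_compX2 n p : eval_root n.+1 (p \Po 'X^2) = eval_root n p.
Proof.
rewrite /eval_root /= map_comp_poly rmorphXn /= map_polyX !horner_evalE.
by rewrite horner_comp hornerXn xS.
Qed.

Lemma laurent_eval n p : laurent iota x n (eval_root n p).
Proof.
have [A1 AB AM] := adjoin2_subring iota (x n) (x n)^-1.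
have gen : range iota `|` [set x n; (x n)^-1] `<=` laurent iota x n.
  exact: sub_gen_smallest.
have A0 : laurent iota x n 0.
  by apply/set_mem; rewrite -[0](subrr 1); exact: AB.
have AD y z : laurent iota x n y -> laurent iota x n z ->
    laurent iota x n (y + z).
  move=> yA zA; apply/set_mem; rewrite -[z]opprK; apply: (AB); first exact/mem_set.
  by rewrite -[- z]sub0r; apply: (AB); exact/mem_set.
elim/poly_ind: p => [|p c IHp]; first by rewrite rmorph0.
rewrite rmorphD rmorphM /= eval_rootC eval_rootX; apply: AD.
  by apply/set_mem/AM; apply/mem_set => //; apply: gen; right; left.
by apply: gen; left; exists c.
Qed.

(** The elements that some power of [x n] carries into F[x_n] form a subring containing the
    generators of D_n. *)
Lemma laurentP n z : laurent iota x n z ->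
  exists k p, z * x n ^+ k = eval_root n p.
Proof.
move: z; apply: smallest_sub.
  split.
  - by apply/mem_set; exists 0%N, 1; rewrite rmorph1 mul1r.
  - move=> y z /set_mem[k [p pE]] /set_mem[j [q qE]]; apply/mem_set.
    exists (k + j)%N, (p * 'X^j - q * 'X^k).
    by rewrite rmorphB !rmorphM !rmorphXn /= eval_rootX -pE -qE exprD; ring.
  - move=> y z /set_mem[k [p pE]] /set_mem[j [q qE]]; apply/mem_set.
    by exists (k + j)%N, (p * q); rewrite rmorphM /= -pE -qE exprD; ring.
move=> _ [[c _ <-]|[->|->]].
- by exists 0%N, c%:P; rewrite eval_rootC mulr1.
- by exists 0%N, 'X; rewrite eval_rootX mulr1.
- by exists 1%N, 1; rewrite rmorph1 mulVf // x_neq0.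
Qed.

Lemma exists_eval n p : exists a : D, dyadic_val a = eval_root n p.
Proof.
apply: (@subring_val_surj _ (Subring (laurent_union_subring iota xS))).
by exists n => //; exact: laurent_eval.
Qed.

Definition ev n p : D := xget 0 [set a | dyadic_val a = eval_root n p].

Lemma evE n p : dyadic_val (ev n p) = eval_root n p.
Proof. by have [a aE] := exists_eval n p; rewrite /ev; case: xgetP => // /(_ a). Qed.

Fact ev_zmod_morphism n : zmod_morphism (ev n).
Proof. by move=> p q; apply: dyadic_val_inj; rewrite rmorphB /= !evE rmorphB. Qed.

Fact ev_monoid_morphism n : monoid_morphism (ev n).
Proof.
split; first by apply: dyadic_val_inj; rewrite evE !rmorph1.
by move=> p q; apply: dyadic_val_inj; rewrite rmorphM /= !evE rmorphM.
Qed.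

HB.instance Definition _ n :=
  GRing.isZmodMorphism.Build _ _ (ev n) (ev_zmod_morphism n).
HB.instance Definition _ n :=
  GRing.isMonoidMorphism.Build _ _ (ev n) (ev_monoid_morphism n).

Lemma ev_inj n : injective (ev n).
Proof.
move=> p q pq; apply: (@eval_root_inj n); rewrite -!evE.
by rewrite pq.
Qed.

Lemma ev_compX2 n p : ev n.+1 (p \Po 'X^2) = ev n p.
Proof. by apply: dyadic_val_inj; rewrite !evE eval_root_compX2. Qed.

(** * The subrings D_n of D and the extension from D_n to D_(n+1) *)

Let X n := ev n 'X.

Lemma evXS n : X n.+1 ^+ 2 = X n.
Proof. by rewrite /X -rmorphXn -[in RHS]ev_compX2 comp_polyX. Qed.

Lemma evX_unit n : X n \is a GRing.unit.
Proof.
have [|y yE] := @subring_val_surj _ (Subring (laurent_union_subring iota xS)) (x n)^-1.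
  by exists n => //; apply: sub_gen_smallest; right; right.
apply/divides1; exists y; apply: dyadic_val_inj.
rewrite rmorph1 rmorphM /= evE eval_rootX [dyadic_val y]yE mulVf //.
exact: x_neq0.
Qed.

(* The image of F[X^(1/2^n), X^(-1/2^n)] in D. *)
Definition level n (a : D) := exists k p, a * X n ^+ k = ev n p.

Lemma level_ev n p : level n (ev n p).
Proof. by exists 0%N, p; rewrite mulr1. Qed.

Lemma levelB n a b : level n a -> level n b -> level n (a - b).
Proof.
move=> [k [p pE]] [j [q qE]]; exists (k + j)%N, (p * 'X^j - q * 'X^k).
by rewrite rmorphB !rmorphM !rmorphXn /= -pE -qE -/(X n) exprD; ring.
Qed.

Lemma levelM n a b : level n a -> level n b -> level n (a * b).
Proof.
move=> [k [p pE]] [j [q qE]]; exists (k + j)%N, (p * q).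
by rewrite rmorphM /= -pE -qE exprD; ring.
Qed.

Lemma levelD n a b : level n a -> level n b -> level n (a + b).
Proof.
move=> an bn; rewrite -[b]opprK -[- b]sub0r; apply: levelB => //.
by apply: levelB => //; rewrite -(rmorph0 (ev n)); exact: level_ev.
Qed.

Lemma level_divX n p k : level n (ev n p / X n ^+ k).
Proof. by exists k, p; rewrite divrK // unitrX // evX_unit. Qed.

Lemma levelX n : level n (X n).
Proof. exact: level_ev. Qed.

Lemma levelXV n : level n (X n)^-1.
Proof. by have := level_divX n 1 1; rewrite rmorph1 mul1r. Qed.

Lemma levelS n a : level n a -> level n.+1 a.
Proof.
move=> [k [p pE]]; exists (2 * k)%N, (p \Po 'X^2).
by rewrite ev_compX2 -pE exprM evXS.
Qed.

Lemma level_le m n a : (m <= n)%N -> level m a -> level n a.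
Proof.
by move=> /subnK <-; elim: (n - m)%N => // k IHk am; apply: levelS; exact: IHk.
Qed.

Lemma exists_level a : exists n, level n a.
Proof.
have [n _ an] := @subring_valP _ (Subring (laurent_union_subring iota xS)) a.
exists n; have [k [p pE]] := laurentP an; exists k, p; apply: dyadic_val_inj.
by rewrite rmorphM rmorphXn /= !evE eval_rootX -pE.
Qed.

Lemma exists_level2 n0 a b : exists n, [/\ (n0 <= n)%N, level n a & level n b].
Proof.
have [[n an] [m bm]] := (exists_level a, exists_level b).
exists (maxn n0 (maxn n m)); split; first exact: leq_maxl.
  by apply: level_le an; rewrite leq_max leq_maxl orbT.
by apply: level_le bm; rewrite leq_max leq_maxr orbT.
Qed.

Lemma level_decomp n a : level n.+1 a ->
  exists u v, [/\ level n u, level n v & a = u + v * X n.+1].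
Proof.
move=> [k [p pE]].
(* A further factor X_(n+1)^k turns the denominator X_(n+1)^k into X_n^k, which is a unit of D_n. *)
have {p pE} [p pE] : exists p, a * X n ^+ k = ev n.+1 p.
  exists (p * 'X^k); rewrite rmorphM rmorphXn /= -/(X _) -pE -evXS -mulrA.
  by rewrite -exprM -exprD mul2n addnn.
have Xk : X n ^+ k \is a GRing.unit by rewrite unitrX // evX_unit.
exists (ev n (even_poly p) / X n ^+ k), (ev n (odd_poly p) / X n ^+ k).
split; [exact: level_divX|exact: level_divX|apply: (mulIr Xk)].
rewrite mulrDl [_ * X n.+1 * _]mulrAC !divrK // pE -[in LHS](poly_even_odd p).
by rewrite rmorphD rmorphM /= !ev_compX2.
Qed.

Lemma level_indep n u v : level n u -> level n v -> u + v * X n.+1 = 0 ->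
  u = 0 /\ v = 0.
Proof.
move=> [k [p pE]] [j [q qE]] uv0.
have [|pX0 qX0] := @poly_even_odd_eq0 F (p * 'X^j) (q * 'X^k).
  apply: (@ev_inj n.+1); rewrite rmorph0 rmorphD [X in _ + X]rmorphM /=.
  rewrite !ev_compX2 !rmorphM !rmorphXn /= -pE -qE -/(X _) -/(X _).
  rewrite -[RHS](mul0r (X n ^+ k * X n ^+ j)) -uv0; ring.
have Xn i : X n ^+ i != 0.
  apply: contraTneq (evX_unit n) => /eqP; rewrite expf_eq0.
  by move=> /andP[_ /eqP->]; rewrite unitr0.
have p0 : p = 0.
  by move/eqP: pX0; rewrite mulf_eq0 expf_eq0 polyX_eq0 andbF orbF => /eqP.
have q0 : q = 0.
  by move/eqP: qX0; rewrite mulf_eq0 expf_eq0 polyX_eq0 andbF orbF => /eqP.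
split; [apply: (mulIf (Xn k))|apply: (mulIf (Xn j))].
  by rewrite pE p0 rmorph0 mul0r.
by rewrite qE q0 rmorph0 mul0r.
Qed.

(** An inverse [b] found at a higher level is u + v Y with Y = X^(1/2^(k+1)). Comparing coefficients
    in ba = 1 gives va = 0, so v = 0 and [b] drops one level. Nonunits can thus be detected among
    Laurent polynomials. *)
Lemma level_unit n a b : level n a -> b * a = 1 -> level n b.
Proof.
move=> an ba; have [m] := exists_level b.
have [mn|/ltnW nm] := leqP m n; first exact: level_le.
move: nm => /subnK <-; elim: (m - n)%N => // k IHk.
rewrite addSn => /level_decomp[u [v [uk vk bE]]].
have ak : level (k + n) a by apply: level_le an; exact: leq_addl.
have [|||_ va] := @level_indep (k + n) (u * a - 1) (v * a).
- by apply: levelB; [exact: levelM|rewrite -(rmorph1 (ev (k + n))); exact: level_ev].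
- exact: levelM.
- by rewrite addrAC mulrAC -mulrDl -bE ba subrr.
apply: IHk; suff v0 : v = 0 by rewrite bE v0 mul0r addr0.
by rewrite -[v]mulr1 -ba mulrCA va mulr0.
Qed.

(** By [level_unit] an inverse would lie in D_n; clearing its denominator makes 'X - c a divisor of
    some 'X^k, which fails on evaluation at c. *)
Lemma ev_XsubC_nonunit n c : c != 0 -> ev n ('X - c%:P) \isn't a GRing.unit.
Proof.
move=> c0; apply/negP => eu.
have [k [p pE]] := level_unit (level_ev n _) (mulVr eu).
have /(congr1 (horner_eval c)) : p * ('X - c%:P) = 'X^k.
  apply: (@ev_inj n); rewrite rmorphM rmorphXn /= -pE -/(X n).
  by rewrite mulrAC mulVr // mul1r.
rewrite !horner_evalE hornerM hornerXsubC subrr mulr0 hornerXn => /esym/eqP.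
by rewrite expf_eq0 (negPf c0) andbF.
Qed.

Lemma eval_form n a : level n a ->
  exists u p, u \is a GRing.unit /\ a = u * ev n p.
Proof.
have Xk k : X n ^+ k \is a GRing.unit by rewrite unitrX // evX_unit.
move=> [k [p pE]]; exists (X n ^+ k)^-1, p.
by rewrite unitrV -pE mulrC mulrK.
Qed.

(** * Bezout property and radical elements of D *)

Lemma dyadic_bezout : bezout_domain D.
Proof.
move=> a b; have [n [_ /eval_form[u [p [uu ->]]] /eval_form[v [q [vu ->]]]]] :=
  exists_level2 0 a b.
have [g [s [t [gE [p' pE] [q' qE]]]]] := bezout_poly p q.
exists (ev n g), (ev n s / u), (ev n t / v); split.
- by rewrite !mulrA !divrK // gE rmorphD !rmorphM.
- by exists (u * ev n p'); rewrite pE rmorphM mulrA.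
- by exists (v * ev n q'); rewrite qE rmorphM mulrA.
Qed.

(** D_n is a predicate on [D] and not a type of its own, so divisibility and radical elements of D_n
    are stated relative to [level n]. *)
Definition level_divides n r b := exists2 c, level n c & b = c * r.

Lemma level_dividesB n r a b : level_divides n r a -> level_divides n r b ->
  level_divides n r (a - b).
Proof.
by move=> [c cn ->] [d dn ->]; exists (c - d); [exact: levelB|ring].
Qed.

Lemma level_dividesM n r a b : level n a -> level_divides n r b ->
  level_divides n r (a * b).
Proof. by move=> an [c cn ->]; exists (a * c); [exact: levelM|rewrite mulrA]. Qed.

Definition level_radical n r := forall b, level n b ->
  level_divides n r (b ^+ 2) -> level_divides n r b.

(* Writing b = u + v Y with Y^2 = X and r | b^2, comparing coefficients gives
   r | u^2 + v^2 X and r | uv, hence r | u^4, so r | u and then r | v. *)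
Lemma level_radicalS n r : 2%:R != 0 :> F -> level n r -> level_radical n r ->
  level_radical n.+1 r.
Proof.
move=> F2 rn rrad b bn [c cn b2].
have [u [v [un vn bE]]] := level_decomp bn.
have [p [q [pn qn cE]]] := level_decomp cn.
have [|||/subr0_eq uvE /subr0_eq uvE2] := @level_indep n
  (u ^+ 2 + v ^+ 2 * X n - p * r) (2 * u * v - q * r).
- apply: levelB; last exact: levelM.
  rewrite !expr2; apply: levelD; first exact: levelM.
  by apply: levelM; [exact: levelM|exact: levelX].
- apply: levelB; last exact: levelM.
  apply: levelM => //; apply: levelM => //.
  by rewrite -(rmorph_nat (ev n) 2); exact: level_ev.
- have : b ^+ 2 - c * r = 0 by rewrite b2 subrr.
  by rewrite bE cE -(evXS n) => <-; ring.
have uv : level_divides n r (u * v).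
  exists (ev n (2^-1)%:P * q); first by apply: levelM => //; exact: level_ev.
  rewrite -mulrA -uvE2 !mulrA -(rmorph_nat (ev n) 2) -rmorphM.
  by rewrite -(rmorph_nat polyC) -polyCM mulVf // rmorph1 mul1r.
have pr : level_divides n r (p * r) by exists p.
have ur : level_divides n r u.
  apply: (rrad) => //; apply: (rrad); first by rewrite expr2; exact: levelM.
  have -> : (u ^+ 2) ^+ 2 = u ^+ 2 * (p * r) - (u * v * X n) * (u * v).
    by rewrite -uvE; ring.
  apply: level_dividesB; apply: level_dividesM => //.
    by rewrite expr2; exact: levelM.
  by apply: levelM; [exact: levelM|exact: levelX].
have vr : level_divides n r v.
  apply: rrad => //.
  have -> : v ^+ 2 = (X n)^-1 * (p * r - u * u).
    have -> : p * r - u * u = X n * v ^+ 2 by rewrite -uvE; ring.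
    by rewrite mulKr // evX_unit.
  apply: level_dividesM; first exact: levelXV.
  by apply: level_dividesB => //; exact: level_dividesM.
have [[d dn uE] [e en vE]] := (ur, vr).
exists (d + e * X n.+1); last first.
  by rewrite bE uE vE mulrDl mulrAC.
by apply: levelD; [exact: levelS|apply: levelM; [exact: levelS|exact: levelX]].
Qed.

Lemma level_radical_ev n p : radical_element p -> level_radical n (ev n p).
Proof.
move=> prad b [j [f fE]] [c [i [g gE]] b2].
have [w wE] : divides p (f * 'X^i).
  (* Here b = f/X^j and c = g/X^i, so b^2 = c p becomes (f X^i)^2 = g X^(i + 2j) p in the polynomial
     ring. *)
  apply: prad; exists (g * 'X^(i + 2 * j)); apply: (@ev_inj n).
  rewrite exprMn [in RHS]mulrAC !rmorphM !rmorphXn /= -fE -gE -/(X n).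
  transitivity (b ^+ 2 * (X n ^+ j) ^+ 2 * (X n ^+ i) ^+ 2); first by ring.
  by rewrite b2 exprD [(2 * j)%N]mulnC exprM; ring.
have Xij : X n ^+ (j + i) \is a GRing.unit by rewrite unitrX // evX_unit.
exists (ev n w / X n ^+ (j + i)); first exact: level_divX.
apply: (mulIr Xij); rewrite mulrAC divrK // -rmorphM -wE rmorphM rmorphXn /=.
by rewrite -fE exprD mulrA.
Qed.

(** A relation r | b^2 in [D] already holds in some D_m with m >= n, and [level_radicalS] carries
    the radicality of [r] from level n up to m. *)
Lemma dyadic_radical_element n r : 2%:R != 0 :> F -> level n r ->
  level_radical n r -> radical_element r.
Proof.
move=> F2 rn rrad b [c b2]; have [m [nm bm cm]] := exists_level2 n b c.
have {rn rrad nm} : level m r /\ level_radical m r.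
  move: nm => /subnK <-; elim: (m - n)%N => // k [rk rradk].
  by split; [exact: levelS|exact: level_radicalS].
move=> [_ /(_ b bm)[|d _ bd]]; first by exists c.
by exists d.
Qed.

Lemma dyadic_radically_bounded : 2%:R != 0 :> F -> radically_bounded D.
Proof.
move=> F2 a a0; have [n /eval_form[u [p [uu aE]]]] := exists_level a.
have p0 : p != 0 by apply: contraNneq a0 => p0; rewrite aE p0 rmorph0 mulr0.
have [r [N [r0 rrad [q qE]]]] := radically_bounded_poly p0.
exists (ev n r), N; split.
- by rewrite -(inj_eq (@ev_inj n)) rmorph0 in r0.
- exact: (dyadic_radical_element F2 (level_ev n r) (level_radical_ev rrad)).
- exists (ev n q / u); rewrite -rmorphXn /= qE rmorphM aE.
  by rewrite mulrA divrK.
Qed.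

(** * The divisors X^(1/2^n) - 1 and X^(1/2^n) + 1 of X - 1 *)

Lemma ev_Xsub1E n : ev n ('X - 1%:P) = X n - 1.
Proof. by rewrite rmorphB rmorph1. Qed.

Lemma ev_Xadd1E n : ev n ('X - (-1)%:P) = X n + 1.
Proof. by rewrite rmorphB polyCN rmorphN rmorph1 opprK. Qed.

Lemma Xsub1_nonunit n : X n - 1 \isn't a GRing.unit.
Proof. by rewrite -ev_Xsub1E ev_XsubC_nonunit // oner_neq0. Qed.

Lemma Xadd1_nonunit n : X n + 1 \isn't a GRing.unit.
Proof. by rewrite -ev_Xadd1E ev_XsubC_nonunit // oppr_eq0 oner_neq0. Qed.

Lemma Xsub1_neq0 n : X n - 1 != 0.
Proof.
by rewrite -ev_Xsub1E -(rmorph0 (ev n)) (inj_eq (@ev_inj n)) polyXsubC_eq0.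
Qed.

Lemma Xsub1_mul n : (X n.+1 - 1) * (X n.+1 + 1) = X n - 1.
Proof. by rewrite -(evXS n); ring. Qed.

Lemma Xsub1_divides m n : (m <= n)%N -> divides (X n - 1) (X m - 1).
Proof.
move=> /subnK <-; elim: (n - m)%N => [|k IHk]; first exact: divides_refl.
apply: divides_trans IHk; rewrite addSn -(Xsub1_mul (k + m)).
exact/divides_mulr/divides_refl.
Qed.

Lemma Xadd1_divides m n : (m <= n)%N -> divides (X n.+1 + 1) (X m - 1).
Proof.
move=> /Xsub1_divides; apply: divides_trans; rewrite -(Xsub1_mul n).
exact/divides_mull/divides_refl.
Qed.

Lemma ev_natr n k : ev n k%:R = k%:R.
Proof. exact: rmorph_nat. Qed.

Lemma natr_unit k : k%:R != 0 :> F -> k%:R \is a @GRing.unit D.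
Proof.
move=> k0; rewrite -(ev_natr 0); apply/divides1; exists (ev 0 (k%:R^-1)%:P).
by rewrite -rmorphM -(rmorph_nat polyC) -polyCM mulVf // !rmorph1.
Qed.

(* Distinct X^(1/2^n) + 1 are coprime since 2 is a unit, and all of them
   divide X - 1. *)
Lemma infinite_maximal_ideals_at_Xsub1 : 2%:R != 0 :> F ->
  infinite_set (maximal_ideals_at (X 0 - 1)).
Proof.
move=> F2 fin; have /choice[M MP] n :
    exists M, maximal_ideals_at (X n.+1 + 1) M.
  exact/exists_maximal_at/Xadd1_nonunit.
have Mid n : is_ideal (M n) by have [[[]]] := MP n.
have nMlt i j : (i < j)%N -> M i <> M j.
  move=> ij Mij; have [_ Mi] := MP i; have [Mjmax Mj] := MP j.
  (* As i < j, X_(j+1) + 1 divides X_(i+1) - 1. A common maximal ideal therefore contains both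
     X_(i+1) + 1 and X_(i+1) - 1, and their difference 2. *)
  have : M j 2%:R.
    have -> : 2%:R = 1 * (X i.+1 + 1) + -1 * (X i.+1 - 1) :> D by ring.
    apply: ideal_comb => //; first by rewrite -Mij.
    exact: ideal_divides (Xadd1_divides ij) Mj.
  by move=> /(maximal_nonunit Mjmax); rewrite natr_unit.
apply: infinite_nat; have -> : [set: nat] = M @^-1` maximal_ideals_at (X 0 - 1).
  apply/seteqP; split=> // n _; have [Mmax Mn] := MP n; split=> //.
  exact: ideal_divides (Xadd1_divides (leq0n n)) Mn.
apply: finite_preimage fin => i j _ _ Mij.
by case: (ltngtP i j) => // [/nMlt //|/nMlt/(_ (esym Mij))].
Qed.

(** * Characteristic 2 *)

Section Char2.
Hypothesis F2 : 2%:R = 0 :> F.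

Lemma dyadic_char2 : 2%:R = 0 :> D.
Proof. by rewrite -(ev_natr 0) -(rmorph_nat polyC) F2 !rmorph0. Qed.

Lemma Xsub1_sqr n : (X n.+1 - 1) ^+ 2 = X n - 1.
Proof.
have -> : (X n.+1 - 1) ^+ 2 = X n.+1 ^+ 2 - 1 - 2%:R * (X n.+1 - 1) by ring.
by rewrite dyadic_char2 mul0r subr0 evXS.
Qed.

(** In characteristic 2 squaring is additive, and it sends X_(n+1) to X_n. *)
Lemma level_sqr n a : level n.+1 a -> level n (a ^+ 2).
Proof.
move=> /level_decomp[u [v [un vn ->]]].
have -> : (u + v * X n.+1) ^+ 2 =
    u * u + v * v * X n.+1 ^+ 2 + 2%:R * (u * v * X n.+1) by ring.
rewrite dyadic_char2 mul0r addr0 evXS; apply: levelD; first exact: levelM.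
by apply: levelM; [exact: levelM|exact: levelX].
Qed.

Lemma level_exp2 n a : exists k, level n (a ^+ (2 ^ k)).
Proof.
have [m [nm am _]] := exists_level2 n a a; exists (m - n)%N.
move: nm am => /subnK {1}<-; elim: (m - n)%N a => [|k IHk] a an.
  by rewrite expn0 expr1.
by rewrite expnS exprM; apply/IHk/level_sqr.
Qed.

(* If M and M' are distinct and contain f, then M contains a Laurent
   polynomial g outside M', and gcd(f, g) is a proper divisor of f. *)
Lemma finite_maximal_ideals_at_ev n p : p != 0 ->
  finite_set (maximal_ideals_at (ev n p)).
Proof.
have [s] := ubnP (size p); elim: s p => // s IHs p /ltnSE ps p0.
have [M1|] := pselect (forall M M', maximal_ideals_at (ev n p) M ->
    maximal_ideals_at (ev n p) M' -> M = M').
  have [[M MP]|M0] := pselect (exists M, maximal_ideals_at (ev n p) M).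
    by apply: (sub_finite_set _ (finite_set1 M)) => M' /M1; exact.
  by apply: (sub_finite_set _ (@finite_set0 _)) => M MP; apply: M0; exists M.
move=> /existsNP[M /existsNP[M' /not_implyP[[Mmax Mp] /not_implyP[[M'max M'p] MM']]]].
have [b Mb nM'b] : exists2 b, M b & ~ M' b.
  apply: contrapT => nb; apply: MM'; have [_ Mmax'] := Mmax.
  apply/esym/Mmax'; first by have [] := M'max.
  by move=> b Mb; apply: contrapT => nM'b; apply: nb; exists b.
have [[[Mid _] _] [[M'id _] _]] := (Mmax, M'max).
(* The element [b] may live at any level. A suitable 2-power of it is at level n, and its numerator
   [g] is still in M and outside M'. *)
have [k [j [g gE]]] := level_exp2 n b.
have Mg : M (ev n g).
  rewrite -gE mulrC; have [_ _ MM] := Mid; apply: MM.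
  by apply: ideal_exp => //; rewrite expn_gt0.
have nM'g : ~ M' (ev n g).
  rewrite -gE => /(maximal_mul M'max)[/(maximal_exp M'max)//|].
  by move/(maximal_exp M'max)/(maximal_nonunit M'max); rewrite evX_unit.
have [d [u [v [dE [p' pE] [g' gdE]]]]] := bezout_poly p g.
have Md : M (ev n d).
  by rewrite dE rmorphD !rmorphM; exact: ideal_comb.
have nM'd : ~ M' (ev n d).
  by move=> M'd; apply: nM'g; rewrite gdE rmorphM; have [_ _ MM] := M'id; exact: MM.
have M'p' : M' (ev n p') by move: M'p; rewrite pE rmorphM => /(maximal_mul M'max)[].
have [p'0 d0] : p' != 0 /\ d != 0.
  by move: p0; rewrite pE mulf_eq0 negb_or => /andP[].
(* A nonzero polynomial whose value lies in a maximal ideal is not constant. So both factors of p =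
   p' d have positive degree, and both have smaller size than [p]. *)
have size_gt1 K q : is_maximal_ideal K -> K (ev n q) -> q != 0 -> (1 < size q)%N.
  move=> Kmax Kq q0; rewrite ltnNge; apply/negP => /size1_polyC qE.
  have /negP := maximal_nonunit Kmax Kq; apply; apply/divides1.
  exists (ev n (q`_0)^-1%:P); rewrite -rmorphM [X in _ * X]qE -polyCM mulVf ?rmorph1 //.
  by apply: contraNneq q0 => q00; rewrite qE q00.
have p'1 := size_gt1 _ _ M'max M'p' p'0; have d1 := size_gt1 _ _ Mmax Md d0.
rewrite pE rmorphM maximal_ideals_atM finite_setU.
have sE : size p = (size p' + size d).-1 by rewrite pE size_mul.
split; apply: IHs => //; apply: leq_trans ps; rewrite sE.
  by rewrite -subn1 ltn_subRL addnC ltn_add2l.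
by rewrite -subn1 ltn_subRL ltn_add2r.
Qed.

Lemma dyadic_finite_character : finite_character D.
Proof.
move=> a a0 au; have [n /eval_form[u [p [uu aE]]]] := exists_level a.
have p0 : p != 0 by apply: contraNneq a0 => p0; rewrite aE p0 rmorph0 mulr0.
apply: sub_finite_set (finite_maximal_ideals_at_ev n p0) => M [Mmax].
rewrite aE => /(maximal_mul Mmax)[/(maximal_nonunit Mmax)|Mp].
  by rewrite uu.
by split.
Qed.

End Char2.

End DyadicLaurentTheory.

Theorem theorem4p3 (F L : fieldType) (iota : {rmorphism F -> L})
    (x : nat -> L) (x0_transcendental : ~ algebraicOver iota (x 0%N))
    (xS : forall n, x n.+1 ^+ 2 = x n) :
  let D := dyadic_laurent iota xS in
  [<-> 2%N \notin [pchar F];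
       almost_dedekind D;
       sp_domain D;
       forall a : D, a \isn't a GRing.unit -> ~ prime_product a ->
         infinite_set (maximal_ideals_at a);
       ~ finite_character D;
       forall I : set D, is_proper_ideal I -> is_principal_ideal I ->
         exists2 s : seq (set D),
           (forall J, J \in s -> is_radical_ideal J /\ is_principal_ideal J)
           & I = ideal_prod s].
Proof.
move=> D; pose y n : D := ev iota xS n 'X - 1.
have y0 n : y n != 0 := Xsub1_neq0 x0_transcendental xS n.
have yu n : y n \isn't a GRing.unit := Xsub1_nonunit x0_transcendental xS n.
(* The characteristic settles all six statements: if 2 = 0 in [F] each one is refuted, otherwise
   each one is proved. Every implication of the cycle thus follows from its hypothesis alone or its
   conclusion alone. *)
have [F2|F2] := eqVneq (2%:R : F) 0.
  have yS n : y n.+1 ^+ 2 = y n := Xsub1_sqr iota xS F2 n.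
  have Dfin := dyadic_finite_character x0_transcendental (xS := xS) F2.
  have -> : (2%N \notin [pchar F]) = false by rewrite inE /= F2 eqxx.
  tfae=> //.
  - by move=> /(root_chain_not_almost_dedekind yS y0 yu).
  - move=> /(_ (principal (y 0%N)))[|s srad yE]; first exact/principal_proper.
    by have := root_chain_not_radical_product yS y0 yu srad yE.
  - move=> /(_ (y 0%N) (yu 0%N) (root_chain_not_prime_product yS y0 yu)).
    by have := Dfin _ (y0 0%N) (yu 0%N).
  - move=> /(_ (principal (y 0%N)))[||s srad yE]; first exact/principal_proper.
      by exists (y 0%N).
    have := @root_chain_not_radical_product _ y yS y0 yu s _ yE.
    by case => J /srad[].
have F2' : 2%N \notin [pchar F] by rewrite inE /= F2.
have bezoutD := dyadic_bezout x0_transcendental (xS := xS).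
have boundD := dyadic_radically_bounded x0_transcendental (xS := xS) F2.
have inf := infinite_maximal_ideals_at_Xsub1 x0_transcendental (xS := xS) F2.
tfae=> // _.
- by apply: bezout_almost_dedekind => //; exists (y 0%N).
- exact: bezout_sp_domain.
(* Zero is a nonunit too; it lies in every maximal ideal, in particular in the infinitely many that
   contain X - 1. *)
- move=> a au nprime; have [->|a0] := eqVneq a 0.
    apply: sub_infinite_set inf => M [Mmax _]; split=> //.
    by have [[[]]] := Mmax.
  by move=> fin; apply/nprime/finite_maximal_prime_product.
- by move=> /(_ _ (y0 0%N) (yu 0%N)).
- by move=> I _; exact: radical_principal_factorization.
Qed.
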